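(* Let $U$ be a two-qubit fermionic gate, i.e. a two-qubit unitary commuting with $Z\otimes Z$, acting on two qubits of an $n$-qubit system, and let $t_1,t_2,t_3,t_4,a,b,c\in\mathbb{R}$ be parameters for which, up to a global phase, $$U=(R_Z(t_1)\otimes R_Z(t_2))\,R_{XX}(a)\,R_{YY}(b)\,R_{ZZ}(c)\,(R_Z(t_3)\otimes R_Z(t_4)).$$ If either 1) $U$ acts on nearest-neighbour qubits $j,j+1$, or 2) $U$ is a diagonal gate (acting on any two qubits), then $U$ has unitary extent $$\xi(U)=1+|\sin c|,$$ and (up to the same global phase) $$U=(R_Z(t_1)\otimes R_Z(t_2))\,R_{XX}(a)\,R_{YY}(b)\left(\cos\left(\tfrac c2\right)I-i\sin\left(\tfrac c2\right)Z\otimes Z\right)(R_Z(t_3)\otimes R_Z(t_4))$$ is an optimal decomposition with respect to the unitary extent (as a linear combination, with coefficients $\cos(c/2)$ and $-i\sin(c/2)$, of the two Gaussian unitaries obtained by expanding the bracket).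
   Context: On $n$ qubits let $c_{2j-1}=Z^{\otimes(j-1)}\otimes X\otimes I^{\otimes(n-j)}$ and $c_{2j}=Z^{\otimes(j-1)}\otimes Y\otimes I^{\otimes(n-j)}$, $j=1,\dots,n$. The set $G_n$ of Gaussian unitaries consists of the $n$-qubit unitaries $V$ for which there is $R\in O(2n)$ with $Vc_jV^\dagger=\sum_kR_{j,k}c_k$ for all $j$. The unitary extent of an $n$-qubit unitary $U$ is $\xi(U)=\min\{\|c\|_1^2: U=\sum_{j=1}^{\chi}c_jK_j,\ \chi\in\mathbb{N},\ K_j\in G_n,\ c_j\in\mathbb{C}\}$, where $\|c\|_1=\sum_j|c_j|$. A decomposition $U=\sum_jc_jK_j$ with $K_j\in G_n$ is optimal if $\xi(U)=\|c\|_1^2$. A two-qubit gate acting on qubits $j,k$ is regarded as an $n$-qubit unitary acting trivially on the other qubits. For a Pauli string $P$, $R_P(\theta)=\exp(-i\theta P/2)$; $R_{PP'}(\theta)=\exp(-i\theta P\otimes P'/2)$. It is a known fact that every two-qubit unitary commuting with $Z\otimes Z$ admits, up to a global phase, parameters $t_1,\dots,t_4,a,b,c$ as in the claim. *)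

(* Defs.v *)
(* MathComp / MathComp-Analysis; complex numbers are R[i] over R : realType. *)
From HB Require Import structures.
From mathcomp Require Export all_boot all_order all_algebra.
From mathcomp Require Export all_classical reals topology normedtype sequences.
From mathcomp Require Export trigo.
From mathcomp Require Export mxtens complex.
Export numFieldNormedType.Exports.

Set Implicit Arguments.
Unset Strict Implicit.
Unset Printing Implicit Defensive.

Import Order.TTheory GRing.Theory Num.Theory.
Import ComplexField.Normc.

Local Open Scope classical_set_scope.
Local Open Scope sesquilinear_scope.
Local Open Scope ring_scope.
Local Open Scope complex_scope.

(* Limit for the entrywise (product) topology; the series always converges. *)
Definition expmx (K : numFieldType) (d : nat) (A : 'M[K]_d) : 'M[K]_d :=
  lim (series (fun k : nat => (k`!%:R : K)^-1 *: A ^+ k) @ \oo).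

Section Qubits.
Variable R : realType.
Local Notation C := R[i].

Definition pauliX : 'M[C]_2 := \matrix_(r, s) (r != s)%:R.

Definition pauliY : 'M[C]_2 :=
  \matrix_(r, s) if r == s then 0 else if r == 0 then - 'i%C else 'i%C.

Definition pauliZ : 'M[C]_2 := \matrix_(r, s) ((r == s)%:R * (-1) ^+ r).

Definition rotation (d : nat) (P : 'M[C]_d) (theta : R) : 'M[C]_d :=
  expmx ((- ('i%C * (theta / 2)%:C)) *: P).

Definition RZ (theta : R) : 'M[C]_2 := rotation pauliZ theta.

Definition Rpair (P Q : 'M[C]_2) (theta : R) : 'M[C]_(2 * 2) :=
  rotation (P *t Q) theta.

(* This is 2 ^ n, in a form such that qdim n.+1 is convertible to
   2 * qdim n, so that iterated tensor products need no cast. *)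
Definition qdim (n : nat) : nat := iter n (muln 2) 1%N.

Lemma qdimE (n : nat) : qdim n = (2 ^ n)%N.
Proof. by elim: n => //= n ->; rewrite expnS. Qed.

(* f 0 (x) f 1 (x) ... (x) f n.-1; qubits are numbered from 0. *)
Fixpoint tensn (n : nat) (f : nat -> 'M[C]_2) : 'M[C]_(qdim n) :=
  if n is m.+1 then f 0%N *t tensn m (fun l => f l.+1) else 1%:M.

(* The Majorana operators are numbered from 0: with m = 2j and m = 2j+1 one
   gets Z on the first j qubits, followed by X, respectively Y, on qubit j. *)
Definition majorana (n : nat) (m : 'I_(2 * n)) : 'M[C]_(qdim n) :=
  tensn n (fun l => if (l < m./2)%N then pauliZ
                    else if l == m./2 then (if odd m then pauliY else pauliX)
                    else 1%:M).

Definition gaussian_unitary (n : nat) (V : 'M[C]_(qdim n)) : Prop :=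
  V \is unitarymx /\
  exists2 O : 'M[R]_(2 * n), O *m O^T = 1%:M &
    forall j, V *m majorana j *m V ^t* = \sum_k (O j k)%:C *: majorana k.

(* The linear extension of A (x) B |-> A on qubit j, B on qubit k, obtained
   by expanding U in matrix units E_(r, r') (x) E_(s, s'). *)
Definition on_qubits (n : nat) (j k : 'I_n) (U : 'M[C]_(2 * 2)) :
    'M[C]_(qdim n) :=
  \sum_(r < 2) \sum_(s < 2) \sum_(r' < 2) \sum_(s' < 2)
    U (mxtens_index (r, s)) (mxtens_index (r', s')) *:
    tensn n (fun l => if l == j then delta_mx r r'
                      else if l == k then delta_mx s s'
                      else 1%:M).

Definition norm1 (chi : nat) (c : chi.-tuple C) : R :=
  \sum_(i < chi) normc (tnth c i).

Definition gaussian_decomposition (n : nat) (V : 'M[C]_(qdim n)) (chi : nat)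
    (c : chi.-tuple C) (K : chi.-tuple 'M[C]_(qdim n)) : Prop :=
  (forall i, gaussian_unitary (tnth K i)) /\
  V = \sum_(i < chi) tnth c i *: tnth K i.

Definition extent_values (n : nat) (V : 'M[C]_(qdim n)) : set R :=
  [set x | exists (chi : nat) (c : chi.-tuple C)
             (K : chi.-tuple 'M[C]_(qdim n)),
             gaussian_decomposition V c K /\ x = norm1 c ^+ 2].

(* The least element of extent_values V, with junk value 0 if there is none.
   For V != 0 all extent values are positive, so 0 then means "no minimum". *)
Definition unitary_extent (n : nat) (V : 'M[C]_(qdim n)) : R :=
  xget 0 (extent_values V `&` lbound (extent_values V)).

Definition optimal_decomposition (n : nat) (V : 'M[C]_(qdim n)) (chi : nat)
    (c : chi.-tuple C) (K : chi.-tuple 'M[C]_(qdim n)) : Prop :=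
  gaussian_decomposition V c K /\ unitary_extent V = norm1 c ^+ 2.

(* The canonical form of a fermionic gate, with M in place of R_ZZ(c). *)
Definition gate_form (t1 t2 t3 t4 a b : R) (M : 'M[C]_(2 * 2)) :
    'M[C]_(2 * 2) :=
  (RZ t1 *t RZ t2) *m Rpair pauliX pauliX a *m Rpair pauliY pauliY b
    *m M *m (RZ t3 *t RZ t4).

End Qubits.

Arguments pauliX {R}.
Arguments pauliY {R}.
Arguments pauliZ {R}.

(* Main.v *)
(* K is Gaussian exactly when conjugation by K acts on the Majorana operators
   c_k by a real orthogonal matrix. There is a unitary Q such that
   J(K) = Q conj(K) Q satisfies J(c_k) = (-1)^n c_k for all k; then J(K) induces
   the same orthogonal matrix as K, so J(K) = lambda K because the c_k act
   irreducibly. With P = Z_j Z_k, which J fixes, comparing traces shows that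
   conj(tr K) tr(P K) is real. Hence |s tr K + i t tr(P K)|^2 =
   |tr K|^2 + |tr(P K)|^2 <= 4^n for all signs s, t, by Bessel's inequality for
   the orthogonal pair I, P.
   Since R_ZZ(c) commutes with the other ZZ-symmetric factors, the gate is
   W (cos(c/2) I - i sin(c/2) P) with W Gaussian, and the functional above,
   applied after multiplication by W^*, bounds the 1-norm of every decomposition
   below by |cos(c/2)| + |sin(c/2)|. *)
From HB Require Import structures.
Require Import Defs.
From mathcomp Require Import ring lra zify.

Set Implicit Arguments.
Unset Strict Implicit.
Unset Printing Implicit Defensive.

Import Order.TTheory GRing.Theory Num.Theory.
Import ComplexField.Normc.
Local Open Scope ring_scope.
Local Open Scope complex_scope.
Local Open Scope sesquilinear_scope.

(** * The exponential of an involution *)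

Section Exponential.
Variable R : realType.
Local Open Scope classical_set_scope.
Local Notation C := R[i].

(* Convergence is stated with norms because R[i] has no canonical topology: the
   limit in expmx is taken in R[i] seen as an abstract numFieldType. *)
Lemma expmx_cvg (K : numFieldType) d (A P : 'M[K]_d) (u v : nat -> K) (l m : K) :
  (forall e, 0 < e -> \forall k \near \oo, `|l - u k| < e) ->
  (forall e, 0 < e -> \forall k \near \oo, `|m - v k| < e) ->
  series (fun k : nat => (k`!%:R : K)^-1 *: A ^+ k)
    = (fun k => u k *: 1%:M + v k *: P) ->
  expmx A = l *: 1%:M + m *: P.
Proof.
move=> /cvgrPdist_lt ul /cvgrPdist_lt vm; rewrite /expmx => ->.
apply/cvg_lim; first exact: norm_hausdorff.
by apply: cvgD; apply: cvgZr_tmp.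
Qed.

(** A positive element of [R[i]] is real, so the tolerance [e] can be replaced by its real part and
    the distance measured in [R]. *)
Lemma near_real_complex (u : nat -> R) (l : R) :
  u @ \oo --> l -> forall e : C, 0 < e -> \forall k \near \oo, `|l%:C - (u k)%:C| < e.
Proof.
move=> /cvgrPdist_lt ul e e0.
have eR : e = (complex.Re e)%:C by rewrite RRe_real ?gtr0_real.
have Re0 : 0 < complex.Re e by move: e0; rewrite eR ltcR.
have := ul _ Re0; apply: filterS => k H.
by rewrite -rmorphB /= normc_def /= expr0n addr0 sqrtr_sqr eR ltcR.
Qed.

(** Even powers of the involution are [1%:M] and odd ones are [P]; for each [k] the coefficient of
    the wrong parity is zero. *)
Lemma expimx_coeff d (P : 'M[C]_d) (t : R) k : P *m P = 1%:M ->
  (k`!%:R : C)^-1 *: ((- ('i%C * t%:C)) *: P) ^+ k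
  = (cos_coeff t k)%:C *: 1%:M + (- ('i%C * (sin_coeff t k)%:C)) *: P.
Proof.
move=> PP.
have Pk : P ^+ k = if odd k then P else 1%:M.
  rewrite -{1}(odd_double_half k) exprD -mul2n exprM expr2.
  rewrite -[P * P]/(P *m P) PP -[1%:M]/(1 : 'M_d) expr1n mulr1.
  by case: (odd k); rewrite ?expr1 ?expr0.
have exprZ z : (z *: P) ^+ k = z ^+ k *: P ^+ k.
  elim: k {Pk} => [|m IH]; first by rewrite !expr0 scale1r.
  by rewrite !exprS IH -[LHS]/((z *: P) *m _) -scalemxAl -scalemxAr scalerA.
rewrite exprZ Pk scalerA.
have -> : (- ('i%C * t%:C) : C) ^+ k =
   (if odd k then - 'i%C else 1) * ((-1) ^+ k./2 * t ^+ k)%:C.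
  rewrite -mulNr exprMn rmorphM rmorphXn rmorphXn rmorphN1 mulrA; congr (_ * _).
  rewrite -{1}(odd_double_half k) exprD -mul2n exprM sqrrN sqr_i.
  by case: (odd k); rewrite ?expr1 ?expr0.
rewrite /cos_coeff /sin_coeff /= -exprnP.
have [ok|ok] := ifPn; rewrite ?(negbTE ok) /= ?mul0r ?mul1r ?rmorph0.
  (* [sin_coeff] uses the exponent [k.-1./2], which agrees with [k./2] for odd [k]. *)
  have -> : k.-1./2 = k./2.
    by move: ok; case: (k) => //= m; rewrite uphalf_half; case: (odd m).
  rewrite scale0r add0r; congr (_ *: _).
  by rewrite [in RHS]rmorphM fmorphV rmorph_nat; ring.
rewrite mulr0 oppr0 scale0r addr0; congr (_ *: _).
by rewrite [in RHS]rmorphM fmorphV rmorph_nat mulrC.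
Qed.

Lemma rotationE d (P : 'M[C]_d) (t : R) : P *m P = 1%:M ->
  rotation P t = (cos (t / 2))%:C *: 1%:M - ('i%C * (sin (t / 2))%:C) *: P.
Proof.
move=> PP; rewrite /rotation /expmx; set x := t / 2.
pose sc := series (cos_coeff x); pose ss := series (sin_coeff x).
rewrite -scaleNr; apply: (@expmx_cvg _ _ _ _ (fun k => (sc k)%:C)
  (fun k => - ('i%C * (ss k)%:C))).
- by rewrite unlock; apply: near_real_complex; exact: is_cvg_series_cos_coeff.
- move=> e e0; rewrite sin.unlock.
  have := near_real_complex (@is_cvg_series_sin_coeff _ x) e0; apply: filterS => k.
  have i1 : `|('i%C : C)| = 1 by rewrite normc_def /= expr0n expr1n add0r sqrtr1.
  by rewrite -opprD normrN -mulrBr normrM i1 mul1r.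
apply/funext => n; rewrite /sc /ss /series /= !rmorph_sum /=.
under eq_bigr do rewrite expimx_coeff//.
by rewrite big_split /= -!scaler_suml mulr_sumr sumrN.
Qed.
End Exponential.

(** * Tensor products and two-qubit gates on n qubits *)

Section Tensor.
Variable F : comPzRingType.

Lemma tensmxDl m n p q (A B : 'M[F]_(m, n)) (M : 'M_(p, q)) :
  (A + B) *t M = A *t M + B *t M.
Proof.
apply/matrixP => i j; case: (mxtens_indexP i) => i1 i2.
by case: (mxtens_indexP j) => j1 j2; rewrite !(tensmxE, mxE) mulrDl.
Qed.

Lemma tensmxDr m n p q (A B : 'M[F]_(m, n)) (M : 'M_(p, q)) :
  M *t (A + B) = M *t A + M *t B.
Proof.
apply/matrixP => i j; case: (mxtens_indexP i) => i1 i2.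
by case: (mxtens_indexP j) => j1 j2; rewrite !(tensmxE, mxE) mulrDr.
Qed.

Lemma tensmxZl m n p q a (A : 'M[F]_(m, n)) (M : 'M_(p, q)) :
  (a *: A) *t M = a *: (A *t M).
Proof.
apply/matrixP => i j; case: (mxtens_indexP i) => i1 i2.
by case: (mxtens_indexP j) => j1 j2; rewrite !(tensmxE, mxE) mulrA.
Qed.

Lemma tensmxZr m n p q a (A : 'M[F]_(m, n)) (M : 'M_(p, q)) :
  M *t (a *: A) = a *: (M *t A).
Proof.
apply/matrixP => i j; case: (mxtens_indexP i) => i1 i2.
by case: (mxtens_indexP j) => j1 j2; rewrite !(tensmxE, mxE) mulrCA.
Qed.

Lemma tensmx_suml (I : finType) m n p q (A : I -> 'M[F]_(m, n)) (M : 'M_(p, q)) :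
  (\sum_i A i) *t M = \sum_i A i *t M.
Proof.
by apply: (big_morph (fun A => A *t M)) => [A1 A2|]; rewrite ?tensmxDl ?tens0mx.
Qed.

Lemma tensmx_sumr (I : finType) m n p q (A : I -> 'M[F]_(m, n)) (M : 'M_(p, q)) :
  M *t (\sum_i A i) = \sum_i M *t A i.
Proof.
by apply: (big_morph (fun A => M *t A)) => [A1 A2|]; rewrite ?tensmxDr ?tensmx0.
Qed.

Lemma tensmx11 m n : (1%:M : 'M[F]_m) *t (1%:M : 'M[F]_n) = 1%:M.
Proof.
apply/matrixP => i j; case: (mxtens_indexP i) => i1 i2.
case: (mxtens_indexP j) => j1 j2; rewrite tensmxE !mxE.
rewrite (can_eq (@mxtens_indexK _ _)) xpair_eqE.
by do 2!case: eqP; rewrite /= ?mulr1 ?mulr0.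
Qed.

Lemma mxtrace_tens m n (A : 'M[F]_m) (B : 'M[F]_n) : \tr (A *t B) = \tr A * \tr B.
Proof.
rewrite /mxtrace mulr_sum; apply: eq_bigr => i _.
by case: (mxtens_indexP i) => i1 i2; rewrite tensmxE mxtens_indexK.
Qed.

Lemma tensmx_delta m n p q (i1 : 'I_m) (i2 : 'I_n) (j1 : 'I_p) (j2 : 'I_q) :
  delta_mx i1 j1 *t delta_mx i2 j2
    = delta_mx (mxtens_index (i1, i2)) (mxtens_index (j1, j2)) :> 'M[F]_(_, _).
Proof.
apply/matrixP => i j; case: (mxtens_indexP i) => r1 r2.
case: (mxtens_indexP j) => s1 s2; rewrite tensmxE !mxE.
rewrite !(can_eq (@mxtens_indexK _ _)) !xpair_eqE.
by do 4!case: eqP; rewrite /= ?mulr1 ?mulr0.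
Qed.

(** Products of matrix units are the matrix units of the tensor product, so properties stable under
    linear combinations need checking on elementary tensors only. *)
Lemma tensmx_ind m n (P : 'M[F]_(m * n) -> Prop) :
  P 0 -> (forall A B, P A -> P B -> P (A + B)) -> (forall a A, P A -> P (a *: A)) ->
  (forall (A : 'M_m) (B : 'M_n), P (A *t B)) -> forall A, P A.
Proof.
move=> P0 PD PZ PT A; rewrite [A]matrix_sum_delta.
apply: big_ind => // i _; apply: big_ind => // j _; apply: PZ.
case: (mxtens_indexP i) => i1 i2; case: (mxtens_indexP j) => j1 j2.
by rewrite -tensmx_delta.
Qed.

End Tensor.

(** * Tensor products of n one-qubit matrices *)

Section Tensn.
Variable R : realType.
Local Notation C := R[i].
Implicit Types (n : nat) (f g : nat -> 'M[C]_2).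

Lemma eq_tensn n f g : (forall l, (l < n)%N -> f l = g l) -> tensn n f = tensn n g.
Proof.
elim: n f g => [//|n IH] f g fg /=.
by rewrite fg// (IH _ (fun l => g l.+1))// => l ln; apply: fg.
Qed.

Lemma tensn1 n f : (forall l, (l < n)%N -> f l = 1%:M) -> tensn n f = 1%:M.
Proof.
elim: n f => [//|n IH] f f1 /=.
by rewrite f1// IH ?tensmx11// => l ln; apply: f1.
Qed.

Lemma tensn_mul n f g : tensn n f *m tensn n g = tensn n (fun l => f l *m g l).
Proof. by elim: n f g => [|n IH] f g /=; rewrite ?mulmx1// tensmx_mul IH. Qed.

Lemma tensn_conj n f : map_mx Num.conj (tensn n f) = tensn n (fun l => map_mx Num.conj (f l)).
Proof. by elim: n f => [|n IH] f /=; rewrite ?map_mx1// map_mxT IH. Qed.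

Lemma tensn_tr n f : (tensn n f)^T = tensn n (fun l => (f l)^T).
Proof. by elim: n f => [|n IH] f /=; rewrite ?trmx1// trmx_tens IH. Qed.

Lemma tensn_adj n f : (tensn n f)^t* = tensn n (fun l => (f l)^t*).
Proof. by rewrite tensn_tr tensn_conj. Qed.

Lemma mxtrace_tensn n f : \tr (tensn n f) = \prod_(l < n) \tr (f l).
Proof.
elim: n f => [|n IH] f /=; first by rewrite big_ord0 mxtrace1.
by rewrite mxtrace_tens IH big_ord_recl.
Qed.

(** Multilinearity in factor [j], the only one in which the strings [G i] may differ from [g]. *)
Lemma tensn_sum (I : finType) (a : I -> C) (G : I -> nat -> 'M[C]_2) n g j :
  (j < n)%N -> (forall l i, l != j -> G i l = g l) -> g j = \sum_i a i *: G i j ->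
  tensn n g = \sum_i a i *: tensn n (G i).
Proof.
elim: n j g G => [//|n IH] [|j] g G /= jn Gg gj.
  rewrite gj tensmx_suml; apply: eq_bigr => i _; rewrite tensmxZl.
  by congr (_ *: (_ *t _)); apply: eq_tensn => l _; rewrite -(Gg _ i).
rewrite (IH j _ (fun i l => G i l.+1))//; last by move=> l i lj; apply: Gg.
rewrite tensmx_sumr; apply: eq_bigr => i _; rewrite tensmxZr.
by rewrite (Gg _ i).
Qed.

Lemma tensn_scale n f g j a : (j < n)%N -> (forall l, l != j -> f l = g l) ->
  g j = a *: f j -> tensn n g = a *: tensn n f.
Proof.
move=> jn fg gj; rewrite (@tensn_sum 'I_1 (fun=> a) (fun=> f) _ _ j)// ?big_ord1//.
by move=> l _; apply: fg.
Qed.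

End Tensn.

(** * Two-qubit matrices acting on n qubits *)

Section OnQubits.
Variables (R : realType) (n : nat) (j k : 'I_n).
Local Notation C := R[i].

Definition two_site (A B : 'M[C]_2) (l : nat) : 'M[C]_2 :=
  if l == j then A else if l == k then B else 1%:M.

Lemma on_qubits_is_linear : linear (@on_qubits R n j k).
Proof.
move=> a A B; rewrite /on_qubits scaler_sumr -big_split; apply: eq_bigr => r _.
rewrite scaler_sumr -big_split; apply: eq_bigr => s _.
rewrite scaler_sumr -big_split; apply: eq_bigr => r' _.
rewrite scaler_sumr -big_split; apply: eq_bigr => s' _.
by rewrite !mxE scalerDl scalerA.
Qed.

HB.instance Definition _ := GRing.isLinear.Build C 'M[C]_(2 * 2) 'M[C]_(qdim n)
  *:%R (@on_qubits R n j k) on_qubits_is_linear.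

Hypothesis neq_jk : j != k.

(** Factor [j] and then factor [k] are expanded in matrix units; since the sites are distinct, the
    two expansions do not interfere. *)
Lemma on_qubits_tens (A B : 'M[C]_2) : on_qubits j k (A *t B) = tensn n (two_site A B).
Proof.
have nkj : (k == j :> nat) = false by rewrite eq_sym; exact: negbTE.
rewrite /on_qubits.
have -> : tensn n (two_site A B) =
    \sum_(r < 2) \sum_(r' < 2) A r r' *: tensn n (two_site (delta_mx r r') B).
  rewrite pair_bigA /=.
  rewrite (@tensn_sum _ _ (fun p => A p.1 p.2) (fun p => two_site (delta_mx p.1 p.2) B) _ _ j)//.
    by move=> l i /negPf lj; rewrite /two_site lj.
  rewrite {1}/two_site eqxx {1}[A]matrix_sum_delta pair_bigA /=.
  by apply: eq_bigr => p _; rewrite /two_site eqxx.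
apply: eq_bigr => r _; rewrite exchange_big; apply: eq_bigr => r' _ /=.
have -> : tensn n (two_site (delta_mx r r') B) =
    \sum_(s < 2) \sum_(s' < 2) B s s' *: tensn n (two_site (delta_mx r r') (delta_mx s s')).
  rewrite pair_bigA /=.
  rewrite (@tensn_sum _ _ (fun p => B p.1 p.2)
    (fun p => two_site (delta_mx r r') (delta_mx p.1 p.2)) _ _ k)//.
    by move=> l i /negPf lk; rewrite /two_site lk.
  rewrite {1}/two_site nkj eqxx {1}[B]matrix_sum_delta pair_bigA /=.
  by apply: eq_bigr => p _; rewrite /two_site nkj eqxx.
rewrite scaler_sumr; apply: eq_bigr => s _; rewrite scaler_sumr.
by apply: eq_bigr => s' _; rewrite scalerA tensmxE.
Qed.

(** Both sides are bilinear, so elementary tensors suffice, and their strings multiply site by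
    site. *)
Lemma on_qubitsM (U V : 'M[C]_(2 * 2)) :
  on_qubits j k (U *m V) = on_qubits j k U *m on_qubits j k V.
Proof.
elim/tensmx_ind: U => [|A B HA HB|a A HA|A B].
- by rewrite mul0mx linear0 mul0mx.
- by rewrite mulmxDl !linearD /= HA HB mulmxDl.
- by rewrite -scalemxAl !linearZ /= HA scalemxAl.
elim/tensmx_ind: V => [|A' B' HA HB|a A' HA|A' B'].
- by rewrite mulmx0 linear0 mulmx0.
- by rewrite mulmxDr !linearD /= HA HB.
- by rewrite -scalemxAr !linearZ /= HA ?scalemxAr.
rewrite tensmx_mul !on_qubits_tens tensn_mul; apply: eq_tensn => l _.
by rewrite /two_site; case: ifP => // _; case: ifP => // _; rewrite mulmx1.
Qed.

Lemma on_qubits1 : on_qubits j k (1%:M : 'M[C]_(2 * 2)) = 1%:M.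
Proof.
rewrite -(@tensmx11 C 2 2) on_qubits_tens; apply: tensn1 => l _.
by rewrite /two_site; do 2?case: ifP.
Qed.

End OnQubits.

(** * Pauli matrices and Majorana operators *)

Section Pauli.
Variable R : realType.
Local Notation C := R[i].
Local Notation X := (@pauliX R).
Local Notation Y := (@pauliY R).
Local Notation Z := (@pauliZ R).

Local Ltac mx2 := apply/matrixP => -[[|[|//]] ?] [[|[|//]] ?];
  rewrite ?(mxE, big_ord_recl, big_ord0) /=
    ?(mul0r, mulr0, mul1r, mulr1, add0r, addr0, mulrN, mulNr, opprK, oppr0, expr0, expr1);
  rewrite -?expr2 ?sqr_i ?opprK ?oppr0.

Lemma mulXX : X *m X = 1%:M. Proof. by mx2. Qed.
Lemma mulYY : Y *m Y = 1%:M. Proof. by mx2. Qed.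
Lemma mulZZ : Z *m Z = 1%:M. Proof. by mx2. Qed.
Lemma mulXY : X *m Y = 'i%C *: Z. Proof. by mx2. Qed.
Lemma mulYX : Y *m X = - 'i%C *: Z. Proof. by mx2. Qed.
Lemma mulYZ : Y *m Z = 'i%C *: X. Proof. by mx2. Qed.
Lemma mulZY : Z *m Y = - 'i%C *: X. Proof. by mx2. Qed.
Lemma mulZX : Z *m X = 'i%C *: Y. Proof. by mx2. Qed.
Lemma mulXZ : X *m Z = - 'i%C *: Y. Proof. by mx2. Qed.

Definition mul_pauli := (mulXX, mulYY, mulZZ, mulXY, mulYX, mulYZ, mulZY, mulZX, mulXZ).

Lemma mulCii : 'i%C * 'i%C = -1 :> C.
Proof. by rewrite -expr2 sqr_i. Qed.

Lemma conjiC : Num.conj ('i%C : C) = - 'i%C.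
Proof. by apply/eqP; rewrite eq_complex /= oppr0 !eqxx. Qed.

Lemma conj_pauliX : map_mx Num.conj X = X.
Proof. by apply/matrixP => i j; rewrite !mxE rmorph_nat. Qed.
Lemma conj_pauliY : map_mx Num.conj Y = - Y.
Proof.
apply/matrixP => i j; rewrite !mxE; case: ifP => _; first by rewrite rmorph0 oppr0.
by case: ifP => _; apply/eqP; rewrite eq_complex /= ?opprK ?oppr0 !eqxx.
Qed.
Lemma conj_pauliZ : map_mx Num.conj Z = Z.
Proof. by apply/matrixP => i j; rewrite !mxE rmorphM rmorph_nat rmorphXn rmorphN1. Qed.

Lemma adj_pauliX : X ^t* = X.
Proof. by rewrite -map_trmx conj_pauliX; mx2. Qed.
Lemma adj_pauliY : Y ^t* = Y.
Proof. by rewrite -map_trmx conj_pauliY; mx2. Qed.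
Lemma adj_pauliZ : Z ^t* = Z.
Proof. by rewrite -map_trmx conj_pauliZ; mx2. Qed.

Lemma trace_pauliZ : \tr Z = 0.
Proof.
by rewrite /mxtrace !big_ord_recl big_ord0 !mxE /= !mul1r expr0 addr0 expr1 subrr.
Qed.

(** Averaging the conjugates by the four Pauli matrices is full depolarisation. *)
Lemma pauli_twirl (A : 'M[C]_2) :
  A + X *m A *m X + Y *m A *m Y + Z *m A *m Z = (2 * \tr A)%:M.
Proof.
(* Equal indices occur with different bound proofs; one common form lets [ring] identify the
   entries. *)
have o0 h : @Ordinal 2 0 h = ord0 by apply: val_inj.
have o1 h : @Ordinal 2 1 h = lift ord0 ord0 by apply: val_inj.
by apply/matrixP => -[[|[|//]] hi] [[|[|//]] hj]; rewrite /mxtrace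
  ?(mxE, big_ord_recl, big_ord0) ?(o0, o1) /= ?expr0 ?expr1; ring: mulCii.
Qed.

End Pauli.

(** * Jordan-Wigner strings: relations, irreducibility and complex conjugation *)

Section Majorana.
Variable R : realType.
Local Notation C := R[i].
Local Notation X := (@pauliX R).
Local Notation Y := (@pauliY R).
Local Notation Z := (@pauliZ R).

(* Convertible to majorana on ordinals; natural number indices make the
   recursion on n cast-free. *)
Definition maj n (m : nat) : 'M[C]_(qdim n) :=
  tensn n (fun l => if (l < m./2)%N then Z
                    else if l == m./2 then (if odd m then Y else X) else 1%:M).

Lemma maj0 n : maj n.+1 0 = X *t (1%:M : 'M_(qdim n)).
Proof. by rewrite /maj /= tensn1. Qed.

Lemma maj1 n : maj n.+1 1 = Y *t (1%:M : 'M_(qdim n)).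
Proof. by rewrite /maj /= tensn1. Qed.

Lemma majSS n m : maj n.+1 m.+2 = Z *t maj n m.
Proof.
rewrite /maj /=; congr (_ *t _); apply: eq_tensn => l _.
by rewrite ltnS eqSS negbK.
Qed.

Lemma maj_adj n m : (maj n m)^t* = maj n m.
Proof.
rewrite /maj tensn_adj; apply: eq_tensn => l _.
case: ifP => _; rewrite ?adj_pauliZ//; case: ifP => _.
  by case: ifP => _; rewrite ?adj_pauliX ?adj_pauliY.
by rewrite trmx1 map_mx1.
Qed.

Lemma maj_sqr n m : (m < 2 * n)%N -> maj n m *m maj n m = 1%:M.
Proof.
elim: n m => [//|n IH] [|[|m]] mn.
- by rewrite maj0 tensmx_mul mulXX mulmx1 tensmx11.
- by rewrite maj1 tensmx_mul mulYY mulmx1 tensmx11.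
by rewrite majSS tensmx_mul mulZZ IH ?tensmx11//; lia.
Qed.

(** If both strings start with Z, the claim passes to the remaining qubits; otherwise the first
    factors are distinct Pauli matrices and the remaining factors commute. *)
Lemma maj_anticomm n p q : (p < 2 * n)%N -> (q < 2 * n)%N -> p != q ->
  maj n p *m maj n q = - (maj n q *m maj n p).
Proof.
have neg m (A B : 'M[C]_2) (M : 'M_m) : A = - B -> A *t M = - (B *t M).
  by move=> ->; rewrite -scaleN1r tensmxZl scaleN1r.
elim: n p q => [//|n IH] [|[|p]] [|[|q]] pn qn pq //.
- by rewrite maj0 maj1 !tensmx_mul; apply: neg; rewrite !mul_pauli scaleNr opprK.
- rewrite maj0 majSS !tensmx_mul mulmx1 mul1mx; apply: neg.
  by rewrite !mul_pauli scaleNr.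
- by rewrite maj0 maj1 !tensmx_mul; apply: neg; rewrite !mul_pauli scaleNr.
- rewrite maj1 majSS !tensmx_mul mulmx1 mul1mx; apply: neg.
  by rewrite !mul_pauli scaleNr opprK.
- rewrite maj0 majSS !tensmx_mul mulmx1 mul1mx; apply: neg.
  by rewrite !mul_pauli scaleNr opprK.
- rewrite maj1 majSS !tensmx_mul mulmx1 mul1mx; apply: neg.
  by rewrite !mul_pauli scaleNr.
rewrite !majSS !tensmx_mul IH; try lia.
by rewrite -scaleN1r tensmxZr scaleN1r.
Qed.

Lemma tensmx1_twirl m (M : 'M[C]_(2 * m)) : exists M' : 'M[C]_m,
  M + (X *t 1%:M) *m M *m (X *t 1%:M) + (Y *t 1%:M) *m M *m (Y *t 1%:M)
    + (Z *t 1%:M) *m M *m (Z *t 1%:M) = (1%:M : 'M_2) *t M'.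
Proof.
elim/tensmx_ind: M => [|A B [A' HA] [B' HB]|a A [A' HA]|A B].
- by exists 0; rewrite !mulmx0 !mul0mx !addr0 tensmx0.
- exists (A' + B'); rewrite tensmxDr -HA -HB !(mulmxDl, mulmxDr).
  by rewrite [RHS]addrACA; congr (_ + _); rewrite [RHS]addrACA; congr (_ + _);
    rewrite [RHS]addrACA.
- by exists (a *: A'); rewrite tensmxZr -HA -!(scalemxAl, scalemxAr) !scalerDr.
exists ((2 * \tr A) *: B).
by rewrite tensmxZr -tensmxZl !tensmx_mul !mul1mx !mulmx1 -!tensmxDl pauli_twirl scalemx1.
Qed.

Lemma tens1mx_inj m (A B : 'M[C]_m) : (1%:M : 'M_2) *t A = 1%:M *t B -> A = B.
Proof.
move=> /matrixP AB; apply/matrixP => i j.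
by have := AB (mxtens_index (0, i)) (mxtens_index (0, j)); rewrite !tensmxE !mxE !mul1r.
Qed.

(** Induction on the number of qubits: a matrix commuting with X, Y and Z on the first qubit equals
    its own averaged twirl, hence is the identity tensor some matrix, and that matrix commutes with
    the shorter strings. *)
Lemma maj_irreducible n (M : 'M[C]_(qdim n)) :
  (forall m, (m < 2 * n)%N -> M *m maj n m = maj n m *m M) ->
  exists lam : C, M = lam%:M.
Proof.
elim: n M => [|n IH] M comM; first by exists (M 0 0); exact: mx11_scalar.
have cX : M *m (X *t 1%:M) = (X *t 1%:M) *m M by rewrite -maj0 comM.
have cY : M *m (Y *t 1%:M) = (Y *t 1%:M) *m M by rewrite -maj1 comM//; lia.
have cZ : M *m (Z *t 1%:M) = (Z *t 1%:M) *m M.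
  have -> : Z *t 1%:M = (- 'i%C) *: ((X *t 1%:M) *m (Y *t (1%:M : 'M[C]_(qdim n)))).
    by rewrite tensmx_mul mulmx1 mulXY tensmxZl scalerA mulNr -expr2 sqr_i opprK scale1r.
  by rewrite -scalemxAl -scalemxAr mulmxA cX -!mulmxA cY.
have [M'] := @tensmx1_twirl (qdim n) M.
rewrite -cX -cY -cZ -!mulmxA !tensmx_mul mulXX mulYY mulZZ !mulmx1 tensmx11 !mulmx1 => defM.
have {}defM : M = 1%:M *t (4^-1 *: M').
  rewrite tensmxZr -defM -!mulr2n -addrA -!mulr2n.
  by rewrite -mulrnA -[M *+ _]scaler_nat scalerA mulVf ?scale1r// pnatr_eq0.
case: (IH (4^-1 *: M')) => [m mn|lam M'E].
  have mn2 : (m.+2 < 2 * n.+1)%N by lia.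
  (* Multiplying by Z on the first qubit cancels the leading Z of [maj n.+1 m.+2]. *)
  have /(congr1 (mulmx (Z *t 1%:M))) := comM m.+2 mn2.
  rewrite majSS defM !tensmx_mul !mulmxA mulZZ !mul1mx mulmx1 mulZZ => H.
  exact: tens1mx_inj H.
by exists lam; rewrite defM M'E -[X in _ *t X]scalemx1 tensmxZr tensmx11 scalemx1.
Qed.

(* A real structure: K |-> Q conj(K) Q is the antiunitary conjugation
   multiplying every Majorana operator by the same sign. *)
Definition conj_string n : 'M[C]_(qdim n) :=
  tensn n (fun l => if odd (n - l) then Y else X).

Lemma conj_string_sqr n : conj_string n *m conj_string n = 1%:M.
Proof.
rewrite /conj_string tensn_mul; apply: tensn1 => l _.
by case: ifP => _; rewrite ?mulYY ?mulXX.
Qed.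

(** A leading Y in [conj_string] gives X and the conjugate of Y the sign $-1$, a leading X gives
    both the sign $+1$; a Z anticommutes with either and flips the sign of the shorter string.
    Alternating the letters makes all these signs agree. *)
Lemma conj_string_maj n m : (m < 2 * n)%N ->
  conj_string n *m map_mx Num.conj (maj n m) = (-1) ^+ n *: (maj n m *m conj_string n).
Proof.
have QS p : conj_string p.+1 = (if odd p.+1 then Y else X) *t conj_string p by [].
elim: n m => [//|n IH] [|[|m]] mn; rewrite QS exprS mulN1r -signr_odd /=.
- rewrite maj0 map_mxT conj_pauliX map_mx1 !tensmx_mul mulmx1 mul1mx -tensmxZl.
  by case: (odd n); rewrite /= !mul_pauli ?scalerA ?expr0 ?expr1 ?opprK ?mul1r ?mulN1r ?scale1r.
- rewrite maj1 map_mxT conj_pauliY map_mx1 !tensmx_mul mulmx1 mul1mx -tensmxZl mulmxN.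
  by case: (odd n); rewrite /= !mul_pauli ?scalerA ?expr0 ?expr1 ?opprK ?mul1r ?mulN1r ?scale1r
    ?scaleN1r ?opprK ?scaleNr ?opprK.
rewrite majSS map_mxT conj_pauliZ !tensmx_mul IH; last by lia.
rewrite -signr_odd tensmxZr -!tensmxZl.
congr (_ *t _).
by case: (odd n); rewrite /= !mul_pauli ?scalerA ?expr0 ?expr1 ?opprK ?mul1r ?mulN1r ?scale1r
    ?scaleN1r ?opprK ?scaleNr ?opprK.
Qed.


End Majorana.

(** * The group of Gaussian unitaries *)

Section Gaussian.
Variables (R : realType) (n : nat).
Local Notation C := R[i].
Local Notation Mx := 'M[C]_(qdim n).
Local Notation c := (@maj R n).
Implicit Types (V W K : Mx) (p q : 'I_(2 * n)).

(** Retains only the reality part of the Gaussian condition; [gaussian_unitary_span] recovers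
    orthogonality. *)
Definition real_maj_span (A : Mx) : Prop :=
  exists o : 'I_(2 * n) -> R, A = \sum_k (o k)%:C *: c k.

Lemma real_maj_span_maj p : real_maj_span (c p).
Proof.
exists (fun k => (k == p)%:R); rewrite (bigD1 p)//= eqxx scale1r big1 ?addr0// => k /negPf ->.
by rewrite scale0r.
Qed.

Lemma real_maj_spanD A B : real_maj_span A -> real_maj_span B -> real_maj_span (A + B).
Proof.
move=> [o ->] [o' ->]; exists (fun k => o k + o' k).
by rewrite -big_split; apply: eq_bigr => k _; rewrite rmorphD scalerDl.
Qed.

Lemma real_maj_spanZ (x : R) A : real_maj_span A -> real_maj_span (x%:C *: A).
Proof.
move=> [o ->]; exists (fun k => x * o k).
by rewrite scaler_sumr; apply: eq_bigr => k _; rewrite rmorphM scalerA.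
Qed.

Lemma maj_car p q : c p *m c q + c q *m c p = ((p == q)%:R * 2)%:M.
Proof.
have [->|pq] := eqVneq p q; first by rewrite maj_sqr// mul1r -raddfD.
by rewrite maj_anticomm// addNr mul0r raddf0.
Qed.

Lemma qdim_gt0 : (0 < qdim n)%N.
Proof. by rewrite qdimE expn_gt0. Qed.

Lemma scalar_mx_qdim_inj (x y : C) : x%:M = y%:M :> Mx -> x = y.
Proof.
by move/matrixP/(_ (Ordinal qdim_gt0) (Ordinal qdim_gt0)); rewrite !mxE eqxx !mulr1n.
Qed.

Lemma unitary_mulVmx V : V \is unitarymx -> V ^t* *m V = 1%:M.
Proof. by move/unitarymxP/mulmx1C. Qed.

(* Conjugation by a unitary preserves the anticommutation relations, which
   makes the matrix of coefficients orthogonal. *)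
Lemma gaussian_unitary_span V : V \is unitarymx ->
  (forall j : 'I_(2 * n), real_maj_span (V *m c j *m V ^t*)) -> gaussian_unitary V.
Proof.
move=> uV spanV; split=> //.
have /boolp.choice[o oE] := spanV.
exists (\matrix_(j, k) o j k); last first.
  by move=> j; rewrite [LHS]oE; apply: eq_bigr => k _; rewrite mxE.
apply/matrixP => j k; apply: complexI; rewrite mxE.
have VV := unitary_mulVmx uV.
have VcV p q : (V *m c p *m V ^t*) *m (V *m c q *m V ^t*) = V *m (c p *m c q) *m V ^t*.
  by rewrite !mulmxA -(mulmxA (V *m c p)) VV mulmx1.
have : (V *m c j *m V ^t*) *m (V *m c k *m V ^t*) +
       (V *m c k *m V ^t*) *m (V *m c j *m V ^t*) = ((j == k)%:R * 2)%:M.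
  rewrite !VcV -mulmxDl -mulmxDr maj_car -scalemx1 -scalemxAr mulmx1 -scalemxAl.
  by rewrite (unitarymxP uV).
rewrite !oE.
have -> : (\sum_i (o j i)%:C *: c i) *m (\sum_i (o k i)%:C *: c i) =
  \sum_i \sum_l ((o j i * o k l)%:C *: (c i *m c l)).
  rewrite mulmx_suml; apply: eq_bigr => i _; rewrite mulmx_sumr; apply: eq_bigr => l _.
  by rewrite -scalemxAl -scalemxAr scalerA rmorphM.
(* The summation indices are swapped so that both double sums carry the same coefficients and add up
   to anticommutators. *)
have -> : (\sum_i (o k i)%:C *: c i) *m (\sum_i (o j i)%:C *: c i) =
  \sum_i \sum_l ((o j i * o k l)%:C *: (c l *m c i)).
  rewrite exchange_big mulmx_suml; apply: eq_bigr => i _.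
  rewrite mulmx_sumr; apply: eq_bigr => l _.
  by rewrite -scalemxAl -scalemxAr scalerA rmorphM mulrC.
rewrite -big_split /=.
under eq_bigr => i _ do
  (rewrite -big_split /=; under eq_bigr do rewrite -scalerDr maj_car -scalemx1 scalerA).
under eq_bigr => i _ do rewrite -scaler_suml.
rewrite -scaler_suml scalemx1 => /scalar_mx_qdim_inj H.
have two0 : (2 : C) != 0 by rewrite pnatr_eq0.
apply: (mulIf two0); rewrite !mxE rmorph_nat -H rmorph_sum mulr_suml; apply: eq_bigr => i _.
rewrite (bigD1 i)//= big1 ?addr0 => [|l /negPf li].
  by rewrite eqxx mul1r !mxE.
by rewrite eq_sym li mul0r mulr0.
Qed.

Lemma gaussian_unitary_inv V (j : 'I_(2 * n)) :
  gaussian_unitary V -> real_maj_span (V *m c j *m V ^t*).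
Proof. by case=> _ [O _ OE]; exists (O j); rewrite -OE. Qed.

Lemma gaussian1 : gaussian_unitary (1%:M : Mx).
Proof.
apply: gaussian_unitary_span => [|j].
  by apply/unitarymxP; rewrite trmx1 map_mx1 mulmx1.
by rewrite trmx1 map_mx1 mulmx1 mul1mx; exact: real_maj_span_maj.
Qed.

Lemma adjmxM m (A B : 'M[C]_m) : (A *m B) ^t* = B ^t* *m A ^t*.
Proof. by rewrite trmx_mul map_mxM. Qed.

Lemma adjmxZ m (a : C) (A : 'M[C]_m) : (a *: A) ^t* = a^*%R *: A ^t*.
Proof. by apply/matrixP => i j; rewrite !mxE rmorphM. Qed.

Lemma adjmxD m (A B : 'M[C]_m) : (A + B) ^t* = A ^t* + B ^t*.
Proof. by apply/matrixP => i j; rewrite !mxE rmorphD. Qed.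

Lemma adjmx1 m : (1%:M : 'M[C]_m) ^t* = 1%:M.
Proof. by rewrite trmx1 map_mx1. Qed.

Lemma gaussianM V W : gaussian_unitary V -> gaussian_unitary W -> gaussian_unitary (V *m W).
Proof.
move=> gV gW; apply: gaussian_unitary_span => [|j].
  by apply: mul_unitarymx; [case: gV | case: gW].
rewrite adjmxM !mulmxA -(mulmxA V) -(mulmxA V).
have [o ->] := gaussian_unitary_inv j gW.
rewrite mulmx_sumr mulmx_suml.
apply: big_ind => [|A B|k _].
- by exists (fun=> 0); rewrite big1// => k _; rewrite scale0r.
- exact: real_maj_spanD.
by rewrite -scalemxAr -scalemxAl; apply: real_maj_spanZ; exact: gaussian_unitary_inv.
Qed.

Lemma gaussianZ (z : C) V : `|z| = 1 -> gaussian_unitary V -> gaussian_unitary (z *: V).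
Proof.
move=> z1 gV; have zz : z * z^*%R = 1 by rewrite -normCK z1 expr1n.
apply: gaussian_unitary_span => [|j].
  case: gV => /unitarymxP uV _; apply/unitarymxP.
  by rewrite adjmxZ -scalemxAl -scalemxAr scalerA zz scale1r.
rewrite adjmxZ -!scalemxAl -scalemxAr scalerA zz scale1r.
exact: gaussian_unitary_inv.
Qed.

(** Inverting the conjugation transposes [O]: column [k] of [O] expresses [c k] through the images
    [V *m c j *m V ^t*]. *)
Lemma gaussian_adj V : gaussian_unitary V -> gaussian_unitary (V ^t*).
Proof.
move=> [uV [O OO OE]]; apply: gaussian_unitary_span => [|k]; first by rewrite trmxC_unitary.
have OO' : O^T *m O = 1%:M by apply: mulmx1C.
have OOE l l' : \sum_j O j l * O j l' = (l == l')%:R.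
  have := congr1 (fun A : 'M_ _ => A l l') OO'; rewrite !mxE => <-.
  by apply: eq_bigr => j _; rewrite mxE.
have VV := unitary_mulVmx uV.
rewrite trmxCK; exists (fun j => O j k).
have -> : c k = \sum_j (O j k)%:C *: (V *m c j *m V ^t*).
  under eq_bigr => j _ do rewrite OE scaler_sumr.
  rewrite exchange_big /=.
  under eq_bigr => l _ do
    (under eq_bigr => j _ do rewrite scalerA -rmorphM; rewrite -scaler_suml -rmorph_sum OOE).
  rewrite (bigD1 k)//= eqxx scale1r big1 ?addr0// => l /negPf lk.
  by rewrite eq_sym lk scale0r.
rewrite mulmx_sumr mulmx_suml; apply: eq_bigr => j _.
by rewrite -scalemxAr -scalemxAl !mulmxA VV mul1mx -mulmxA VV mulmx1.
Qed.

(** The product of the two operators squares to $-1$, so this is an exponential of a multiple of it.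
    Conjugation rotates the plane of [c p] and [c q] by twice the angle and fixes every other
    Majorana operator. *)
Lemma gaussian_rotation p q (x y : R) : p != q -> x ^+ 2 + y ^+ 2 = 1 ->
  gaussian_unitary (x%:C *: 1%:M + y%:C *: (c p *m c q)).
Proof.
move=> pq xy; set B := c p *m c q; set V := _ + _.
have cpp := @maj_sqr R _ _ (ltn_ord p); have cqq := @maj_sqr R _ _ (ltn_ord q).
have cpq : c p *m c q = - (c q *m c p) by exact: maj_anticomm.
have BB : B *m B = - 1%:M.
  by rewrite /B {1}cpq mulNmx -!mulmxA (mulmxA (c p) (c p)) cpp mul1mx cqq.
have Bp : B *m c p = - c q by rewrite /B cpq mulNmx -mulmxA cpp mulmx1.
have pB : c p *m B = c q by rewrite /B mulmxA cpp mul1mx.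
have Bq : B *m c q = c p by rewrite /B -mulmxA cqq mulmx1.
have qB : c q *m B = - c p by rewrite /B cpq mulmxN mulmxA cqq mul1mx.
have conjR (z : R) : (z%:C)^*%R = z%:C by exact: conjc_real.
have Va : V ^t* = x%:C *: 1%:M - y%:C *: B.
  by rewrite adjmxD !adjmxZ adjmx1 adjmxM !maj_adj !conjR /B cpq scalerN opprK.
have VV : V *m V ^t* = 1%:M.
  rewrite Va mulmxDl !mulmxBr -!scalemxAl -!scalemxAr !(mulmx1, mul1mx) BB !scalerN opprK.
  rewrite !scalerA [y%:C * x%:C]mulrC addrA subrK -scalerDl.
  by rewrite -!rmorphM -rmorphD -!expr2 xy scale1r.
have V2 : V *m V = (x ^+ 2 - y ^+ 2)%:C *: 1%:M + (2 * (x * y))%:C *: B.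
  rewrite mulmxDl !mulmxDr -!scalemxAl -!scalemxAr !(mulmx1, mul1mx) BB !scalerN.
  rewrite !scalerA [X in _ + X]addrC addrACA -scalerBl -scalerDl.
  by rewrite -!rmorphM -rmorphB -rmorphD /=; congr (_%:C *: _ + _%:C *: _); ring.
have V2span (r s : 'I_(2 * n)) : r != s -> B *m c r = c s \/ B *m c r = - c s ->
    real_maj_span (V *m V *m c r).
  move=> rs Br; rewrite V2 mulmxDl -!scalemxAl mul1mx.
  apply: real_maj_spanD; apply: real_maj_spanZ; first exact: real_maj_span_maj.
  case: Br => ->; first exact: real_maj_span_maj.
  rewrite -scaleN1r -(rmorphN1 (real_complex R)); apply: real_maj_spanZ.
  exact: real_maj_span_maj.
apply: gaussian_unitary_span => [|r]; first exact/unitarymxP.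
have [->|rp] := eqVneq r p.
  (* [B] anticommutes with [c p], so moving [V ^t*] to the left of [c p] turns it into [V]. *)
  have -> : V *m c p *m V ^t* = V *m V *m c p.
    rewrite Va -!mulmxA; congr (_ *m _).
    by rewrite mulmxBr mulmxDl -!scalemxAr -!scalemxAl mulmx1 mul1mx pB Bp scalerN.
  by apply: (V2span p q) => //; right.
have [->|rq] := eqVneq r q.
  have -> : V *m c q *m V ^t* = V *m V *m c q.
    rewrite Va -!mulmxA; congr (_ *m _).
    by rewrite mulmxBr mulmxDl -!scalemxAr -!scalemxAl mulmx1 mul1mx qB Bq scalerN opprK.
  by apply: (V2span q p); [rewrite eq_sym|left].
(* Here [r] differs from [p] and [q], so moving [c r] through [B] produces two signs, which
   cancel. *)
have -> : V *m c r *m V ^t* = c r.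
  have cr : V *m c r = c r *m V.
    rewrite mulmxDl mulmxDr -!scalemxAr -!scalemxAl mulmx1 mul1mx; congr (_ + _ *: _).
    rewrite /B -mulmxA (@maj_anticomm _ n q r)// 1?eq_sym// mulmxN mulmxA.
    by rewrite (@maj_anticomm _ n p r)// 1?eq_sym// mulNmx opprK mulmxA.
  by rewrite cr -mulmxA VV mulmx1.
exact: real_maj_span_maj.
Qed.

End Gaussian.

(** * The trace inequality *)

Section TraceBound.
Variables (R : realType) (n : nat).
Local Notation C := R[i].
Local Notation Mx := 'M[C]_(qdim n).
Local Notation Q := (@conj_string R n).
Local Notation conjmx A := (map_mx Num.conj A).
Implicit Types K P : Mx.

Lemma gaussian_conj K : gaussian_unitary K ->
  exists lam : C, Q *m conjmx K *m Q = lam *: K.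
Proof.
move=> [uK [O OO OE]]; set K' := Q *m _ *m _.
have KK := unitary_mulVmx uK; have KK' := unitarymxP uK.
have QQ := conj_string_sqr R n.
have Kc (j : 'I_(2 * n)) : K *m maj R n j = \sum_k (O j k)%:C *: (maj R n k *m K).
  have -> : K *m maj R n j = (K *m maj R n j *m K ^t*) *m K by rewrite -mulmxA KK mulmx1.
  by rewrite OE mulmx_suml; apply: eq_bigr => k _; rewrite scalemxAl.
have cK (j : 'I_(2 * n)) : K ^t* *m (\sum_k (O j k)%:C *: maj R n k) = maj R n j *m K ^t*.
  by rewrite -OE !mulmxA KK mul1mx.
have sQ m : (m < 2 * n)%N -> conjmx (maj R n m) *m Q = (-1) ^+ n *: (Q *m maj R n m).
  move=> mn; have := congr1 (fun A => Q *m A *m Q) (conj_string_maj R mn).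
  rewrite !mulmxA QQ mul1mx => ->.
  by rewrite -scalemxAr -scalemxAl !mulmxA -(mulmxA _ Q Q) QQ mulmx1.
(* Complex conjugation leaves the real coefficients [O j k] alone, and the sign $(-1)^n$ occurs
   twice; so [K'] intertwines through the same [O] as [K]. *)
have K'c (j : 'I_(2 * n)) : K' *m maj R n j = (\sum_k (O j k)%:C *: maj R n k) *m K'.
  have sg : (-1) ^+ n * (-1) ^+ n = 1 :> C by rewrite -expr2 sqrr_sign.
  have -> : K' *m maj R n j = (-1) ^+ n *: (Q *m conjmx (K *m maj R n j) *m Q).
    rewrite map_mxM -!mulmxA sQ// -!scalemxAr scalerA sg scale1r.
    by rewrite /K' !mulmxA.
  have conjZ (x : R) (A : Mx) : conjmx (x%:C *: A) = x%:C *: conjmx A.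
    by apply/matrixP => r s; rewrite !mxE rmorphM; congr (_ * _); exact: conjc_real.
  rewrite Kc map_mx_sum mulmx_sumr !mulmx_suml scaler_sumr; apply: eq_bigr => k _.
  rewrite conjZ map_mxM -scalemxAr mulmxA conj_string_maj// -!scalemxAl !scalerA.
  rewrite [_ * (-1) ^+ n]mulrC mulrA sg mul1r.
  by rewrite /K' !mulmxA.
clearbody K'.
have [lam lamE] : exists lam : C, K ^t* *m K' = lam%:M.
  apply: maj_irreducible => m mn.
  by rewrite -mulmxA (K'c (Ordinal mn)) mulmxA cK mulmxA.
exists lam; rewrite -[LHS]mul1mx -KK' -mulmxA -/K' lamE.
by rewrite mul_mx_scalar.
Qed.

Variable P : Mx.
Hypotheses (PP : P *m P = 1%:M) (adjP : P ^t* = P) (conjP : conjmx P = P)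
  (trP : \tr P = 0) (comPQ : P *m Q = Q *m P).

(** Taking the trace of the relation in [gaussian_conj], with and without [P], gives both conjugates
    with the same factor [lam]; [P] passes through [Q] and through entrywise conjugation. *)
Lemma gaussian_trace_real K : gaussian_unitary K ->
  (\tr K)^*%R * \tr (P *m K) = \tr K * (\tr (P *m K))^*%R.
Proof.
move=> /gaussian_conj[lam lamE]; have QQ := conj_string_sqr R n.
have a : (\tr K)^*%R = lam * \tr K.
  have := congr1 mxtrace lamE; rewrite mxtraceZ => <-.
  by rewrite mxtrace_mulC mulmxA QQ mul1mx trace_map_mx.
have b : (\tr (P *m K))^*%R = lam * \tr (P *m K).
  have := congr1 (fun A => \tr (P *m A)) lamE; rewrite -scalemxAr mxtraceZ => <-.
  rewrite !mulmxA [RHS]mxtrace_mulC !mulmxA -comPQ -(mulmxA P) QQ mulmx1.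
  by rewrite -{2}conjP -map_mxM trace_map_mx.
by rewrite a b; ring.
Qed.

Lemma trace_mul_adj_ge0 (E : Mx) : 0 <= \tr (E *m E ^t*).
Proof.
rewrite /mxtrace; apply: sumr_ge0 => i _; rewrite mxE; apply: sumr_ge0 => l _.
by rewrite !mxE mul_conjC_ge0.
Qed.

Lemma trace_adj (A : Mx) : \tr (A ^t*) = (\tr A)^*%R.
Proof. by rewrite trace_map_mx mxtrace_tr. Qed.

(* Bessel's inequality for the Hilbert-Schmidt-orthogonal pair [1, P]. *)
Lemma unitary_trace_bessel K : K \is unitarymx ->
  \tr K * (\tr K)^*%R + \tr (P *m K) * (\tr (P *m K))^*%R <= (qdim n)%:R ^+ 2.
Proof.
move=> /unitarymxP KK; set a := \tr K; set b := \tr (P *m K); set N : C := (qdim n)%:R.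
have N0 : 0 < N by rewrite ltr0n qdim_gt0.
have Nr : N^*%R = N by rewrite conjC_nat.
(* This matrix is $N$ times the residual of projecting [K] onto the span of [1%:M] and [P], both of
   squared Hilbert-Schmidt norm $N$. *)
have := trace_mul_adj_ge0 (N *: K - (a *: 1%:M + b *: P)).
have -> : (N *: K - (a *: 1%:M + b *: P)) ^t* = N *: K ^t* - (a^*%R *: 1%:M + b^*%R *: P).
  by rewrite -scaleN1r !(adjmxD, adjmxZ) adjmx1 adjP rmorphN1 scaleN1r Nr.
rewrite !(mulmxBl, mulmxBr, mulmxDl, mulmxDr) -!(scalemxAl, scalemxAr) !(mulmx1, mul1mx) KK PP.
have trB (A B : Mx) : \tr (A - B) = \tr A - \tr B by exact: raddfB.
rewrite !(trB, mxtraceD, mxtraceZ) mxtrace1 trP.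
rewrite [\tr (K *m P)]mxtrace_mulC -/a -/b trace_adj -/a.
have -> : \tr (P *m K ^t*) = b^*%R by rewrite -trace_adj adjmxM adjP mxtrace_mulC.
rewrite -/N; set a' := a^*%R; set b' := b^*%R => H.
rewrite -subr_ge0 -(pmulr_rge0 _ N0); apply: le_trans H _; rewrite le_eqVlt; apply/orP; left.
by apply/eqP; ring.
Qed.

(** In the squared modulus the cross term is a multiple of $\bar a b-a\bar b$, with $a$, $b$ the two
    traces; it vanishes by [gaussian_trace_real], and the Bessel bound remains. *)
Lemma gaussian_trace_bound K (s t : R) : gaussian_unitary K -> s ^+ 2 = 1 -> t ^+ 2 = 1 ->
  `|s%:C * \tr K + 'i%C * t%:C * \tr (P *m K)| <= (qdim n)%:R.
Proof.
move=> gK s1 t1; have ab := gaussian_trace_real gK.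
have [uK _] := gK; have := unitary_trace_bessel uK.
set a := \tr K in ab *; set b := \tr (P *m K) in ab *.
move=> bessel; rewrite -(@ler_pXn2r _ 2) ?nnegrE ?ler0n//; apply: le_trans bessel.
rewrite normCK rmorphD !rmorphM.
have conjR (z : R) : (z%:C)^*%R = z%:C by exact: conjc_real.
rewrite /= !conjR conjiC.
have ii := mulCii R.
have ss : s%:C * s%:C = 1 by rewrite -rmorphM -expr2 s1.
have tt : t%:C * t%:C = 1 by rewrite -rmorphM -expr2 t1.
set a' := a^*%R in ab *; set b' := b^*%R in ab *; set j := 'i%C in ii *.
suff -> : (s%:C * a + j * t%:C * b) * (s%:C * a' + - j * t%:C * b') = a * a' + b * b' by [].
ring: ab ii ss tt.
Qed.

End TraceBound.

(** * Rotations generated by quadratic Majorana operators *)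

Section Quadratic.
Variables (R : realType) (n : nat).
Local Notation C := R[i].
Local Notation Mx := 'M[C]_(qdim n).
Local Notation X := (@pauliX R).
Local Notation Y := (@pauliY R).
Local Notation Z := (@pauliZ R).

(** The phase makes [S] a Hermitian involution, fit to generate a rotation. *)
Definition maj_quadratic (S : Mx) := exists (p q : 'I_(2 * n)) (s : R),
  [/\ p != q, s ^+ 2 = 1 & S = ('i%C * s%:C) *: (maj R n p *m maj R n q)].

Lemma maj_quadratic_rotation S x y : maj_quadratic S -> x ^+ 2 + y ^+ 2 = 1 ->
  gaussian_unitary (x%:C *: 1%:M - ('i%C * y%:C) *: S).
Proof.
move=> [p [q [s [pq s1 ->]]]] xy; rewrite -scaleNr scalerA.
have -> : - ('i%C * y%:C) * ('i%C * s%:C) = (y * s)%:C :> C.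
  by rewrite [RHS]rmorphM; have := mulCii R; set z := 'i%C => ii; ring: ii.
by apply: gaussian_rotation => //; rewrite exprMn s1 mulr1.
Qed.

Lemma maj_quadratic_gaussian S : maj_quadratic S -> gaussian_unitary S.
Proof.
(* The rotation with $x=0$, $y=1$ is $-iS$; the phase $i$ is then multiplied back in. *)
move=> qS; have := @maj_quadratic_rotation S 0 1 qS.
rewrite expr0n expr1n add0r scale0r add0r mulr1 -scaleNr => /(_ erefl) /(gaussianZ (z := 'i%C)).
rewrite scalerA mulrN -expr2 sqr_i opprK scale1r; apply.
by rewrite normc_def /= expr0n expr1n add0r sqrtr1.
Qed.

(** The common Z strings cancel, and $XY=iZ$ is left on qubit [j]. *)
Lemma maj_Z j : (j < n)%N ->
  maj R n j.*2 *m maj R n j.*2.+1 = 'i%C *: tensn n (fun l => if l == j then Z else 1%:M).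
Proof.
move=> jn; rewrite tensn_mul (@tensn_scale _ _ (fun l => if l == j then Z else 1%:M) _ j 'i%C)//.
  move=> l /negPf lj; rewrite lj doubleK /= uphalf_double lj.
  by case: ifP => _; rewrite ?mulZZ ?mulmx1.
by rewrite doubleK /= uphalf_double ltnn eqxx odd_double /= mulXY.
Qed.

(** On qubit [j] the longer string still has a Z, which meets Y in $YZ=iX$. With adjacent qubits no
    Z is left in between. *)
Lemma maj_XX j : (j.+1 < n)%N ->
  maj R n j.*2.+1 *m maj R n j.+1.*2
    = 'i%C *: tensn n (fun l => if l == j then X else if l == j.+1 then X else 1%:M).
Proof.
move=> jn; rewrite tensn_mul
  (@tensn_scale _ _ (fun l => if l == j then X else if l == j.+1 then X else 1%:M) _ j
    'i%C)//; last 2 first.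
- move=> l lj; rewrite (negPf lj) doubleK [_./2]/= uphalf_double (negPf lj) odd_double.
  have -> : (l < j.+1)%N = (l < j)%N by lia.
  case: (ltnP l j) => lj'; last by rewrite mul1mx.
  by rewrite mulZZ ltn_eqF//; lia.
- by rewrite doubleK [_./2]/= uphalf_double ltnn eqxx ltnSn /= odd_double /= mulYZ.
by lia.
Qed.

(** As for [maj_XX], now with $XZ=-iY$ on qubit [j]. *)
Lemma maj_YY j : (j.+1 < n)%N ->
  maj R n j.*2 *m maj R n j.+1.*2.+1
    = - 'i%C *: tensn n (fun l => if l == j then Y else if l == j.+1 then Y else 1%:M).
Proof.
move=> jn; rewrite tensn_mul
  (@tensn_scale _ _ (fun l => if l == j then Y else if l == j.+1 then Y else 1%:M) _ j
    (- 'i%C))//; last 2 first.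
- move=> l lj; rewrite (negPf lj) doubleK [_./2]/= uphalf_double (negPf lj) /= odd_double.
  have -> : (l < j.+1)%N = (l < j)%N by lia.
  case: (ltnP l j) => lj'; last by rewrite mul1mx.
  by rewrite mulZZ ltn_eqF//; lia.
- by rewrite doubleK [_./2]/= uphalf_double ltnn eqxx ltnSn /= odd_double /= mulXZ.
by lia.
Qed.

Lemma maj_quadraticP (a b : nat) (s : C) (S : Mx) (r : R) :
  (a < 2 * n)%N -> (b < 2 * n)%N -> a != b ->
  maj R n a *m maj R n b = s *: S -> ('i%C * r%:C) * s = 1 -> r ^+ 2 = 1 -> maj_quadratic S.
Proof.
move=> an bn ab cc sr r1; exists (Ordinal an), (Ordinal bn), r; split=> //=.
by rewrite cc scalerA sr scale1r.
Qed.

End Quadratic.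

(** * The factors of the gate *)

Section Diag.
Variables (F : comPzRingType).

Lemma is_diag_mulmx m (A B : 'M[F]_m) : is_diag_mx A -> is_diag_mx B -> is_diag_mx (A *m B).
Proof.
move=> /diag_mxP[a ->] /diag_mxP[b ->]; rewrite mulmx_diag; exact: diag_mx_is_diag.
Qed.

Lemma is_diag_scalemx m a (A : 'M[F]_m) : is_diag_mx A -> is_diag_mx (a *: A).
Proof.
by move=> /is_diag_mxP A0; apply/is_diag_mxP => i j ij; rewrite mxE A0// mulr0.
Qed.

Lemma is_diag_addmx m (A B : 'M[F]_m) : is_diag_mx A -> is_diag_mx B -> is_diag_mx (A + B).
Proof.
move=> /is_diag_mxP A0 /is_diag_mxP B0; apply/is_diag_mxP => i j ij.
by rewrite mxE A0// B0// addr0.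
Qed.

Lemma is_diag_tensmx m p (A : 'M[F]_m) (B : 'M[F]_p) :
  is_diag_mx A -> is_diag_mx B -> is_diag_mx (A *t B).
Proof.
move=> /is_diag_mxP A0 /is_diag_mxP B0; apply/is_diag_mxP => i j.
case: (mxtens_indexP i) => i1 i2; case: (mxtens_indexP j) => j1 j2.
rewrite tensmxE; have [e1|n1] := eqVneq i1 j1; last by rewrite A0// mul0r.
have [e2|n2] := eqVneq i2 j2; last by rewrite [B _ _]B0// mulr0.
by rewrite e1 e2 eqxx.
Qed.

End Diag.

(** * The canonical form of a gate and the diagonal case *)

Section Gate.
Variables (R : realType).
Local Notation C := R[i].
Local Notation X := (@pauliX R).
Local Notation Y := (@pauliY R).
Local Notation Z := (@pauliZ R).

Lemma tensmx_sqr m p (A : 'M[C]_m) (B : 'M[C]_p) : A *m A = 1%:M -> B *m B = 1%:M ->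
  (A *t B) *m (A *t B) = 1%:M.
Proof. by move=> A1 B1; rewrite tensmx_mul A1 B1 tensmx11. Qed.

Lemma tensmx_split m p (A : 'M[C]_m) (B : 'M[C]_p) : A *t B = (A *t 1%:M) *m (1%:M *t B).
Proof. by rewrite tensmx_mul mulmx1 mul1mx. Qed.

Lemma tensmx_comb_l m p (x y : C) (A : 'M[C]_m) :
  (x *: 1%:M - y *: A) *t (1%:M : 'M_p) = x *: 1%:M - y *: (A *t 1%:M).
Proof. by rewrite -!scaleNr tensmxDl !tensmxZl tensmx11. Qed.

Lemma tensmx_comb_r m p (x y : C) (A : 'M[C]_m) :
  (1%:M : 'M_p) *t (x *: 1%:M - y *: A) = x *: 1%:M - y *: (1%:M *t A).
Proof. by rewrite -!scaleNr tensmxDr !tensmxZr tensmx11. Qed.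

Lemma RZE (t : R) : RZ t = (cos (t / 2))%:C *: 1%:M - ('i%C * (sin (t / 2))%:C) *: Z.
Proof. by rewrite /RZ rotationE// mulZZ. Qed.

Lemma rotationNK d (P : 'M[C]_d) (t : R) : P *m P = 1%:M ->
  rotation P t *m rotation P (- t) = 1%:M.
Proof.
move=> PP; rewrite !rotationE// mulNr cosN sinN -!scaleNr.
rewrite mulmxDl !mulmxDr -!scalemxAl -!scalemxAr !(mulmx1, mul1mx) PP !scalerA.
rewrite addrA -[X in X + _]addrA -scalerDl.
set x := cos _; set y := sin _.
have xy : x%:C * x%:C + y%:C * y%:C = 1 :> C.
  by rewrite -!rmorphM -rmorphD -!expr2 cos2Dsin2.
have -> : x%:C * - ('i%C * (- y)%:C) + - ('i%C * y%:C) * x%:C = 0 :> C.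
  by rewrite rmorphN; ring.
rewrite scale0r addr0 -scalerDl rmorphN.
have -> : x%:C * x%:C + - ('i%C * y%:C) * - ('i%C * - y%:C) = 1 :> C.
  by have xx := canRL (addrK _) xy; ring: xx (mulCii R).
by rewrite scale1r.
Qed.

Lemma pauliZ_diag : is_diag_mx Z.
Proof.
apply/is_diag_mxP => i j ij; rewrite mxE.
by rewrite (_ : (i == j) = false) ?mul0r//; apply/negbTE.
Qed.

Lemma rotation_diag d (P : 'M[C]_d) (t : R) : P *m P = 1%:M -> is_diag_mx P ->
  is_diag_mx (rotation P t).
Proof.
move=> PP dP; rewrite rotationE// -scaleNr; apply: is_diag_addmx; apply: is_diag_scalemx => //.
Qed.

Lemma RZ_diag (t : R) : is_diag_mx (RZ t).
Proof. by apply: rotation_diag; [exact: mulZZ | exact: pauliZ_diag]. Qed.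

Lemma mulXXYY : (X *t X) *m (Y *t Y) = - (Z *t Z).
Proof.
by rewrite tensmx_mul mulXY tensmxZl tensmxZr scalerA mulCii scaleN1r.
Qed.

Lemma mul_half_rotations d (A B M : 'M[C]_d) (ca sa cb sb : R) : A *m B = - M ->
  (ca%:C *: 1%:M - ('i%C * sa%:C) *: A) *m (cb%:C *: 1%:M - ('i%C * sb%:C) *: B) =
    (ca * cb)%:C *: 1%:M + (sa * sb)%:C *: M
    - ('i%C * (sa * cb)%:C) *: A - ('i%C * (ca * sb)%:C) *: B.
Proof.
move=> AB; rewrite -!scaleNr mulmxDl !mulmxDr -!scalemxAl -!scalemxAr !(mulmx1, mul1mx) AB.
rewrite scalerN -!scaleNr !scalerA !rmorphM.
have -> : - ('i%C * sa%:C) * - - ('i%C * sb%:C) = sa%:C * sb%:C :> C by ring: (mulCii R).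
rewrite [X in _ + X]addrC addrACA -[RHS]addrA; congr (_ + _).
by rewrite addrC; congr (_ *: _ + _ *: _); ring.
Qed.

(* If the XX-YY part is diagonal, the coefficients of XX and YY vanish. *)
Lemma diag_RXX_RYY (a b : R) :
  is_diag_mx (Rpair X X a *m Rpair Y Y b) ->
  exists e : R, e ^+ 2 = 1 /\
    (Rpair X X a *m Rpair Y Y b = e%:C *: 1%:M \/
     Rpair X X a *m Rpair Y Y b = e%:C *: (Z *t Z)).
Proof.
rewrite /Rpair !rotationE; try by apply: tensmx_sqr; rewrite ?mulXX ?mulYY.
set ca := cos (a / 2); set sa := sin (a / 2); set cb := cos (b / 2); set sb := sin (b / 2).
have -> : (ca%:C *: 1%:M - ('i%C * sa%:C) *: (X *t X)) *m
    (cb%:C *: 1%:M - ('i%C * sb%:C) *: (Y *t Y)) =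
    (ca * cb)%:C *: 1%:M + (sa * sb)%:C *: (Z *t Z)
    - ('i%C * (sa * cb)%:C) *: (X *t X) - ('i%C * (ca * sb)%:C) *: (Y *t Y).
  exact: mul_half_rotations mulXXYY.
move=> /is_diag_mxP dA.
have i0 : 'i%C != 0 :> C 
  by apply/eqP => i0; have /eqP := mulCii R; rewrite i0 mul0r eq_sym oppr_eq0 oner_eq0.
(* At these two off-diagonal positions XX has the entries $1,1$ and YY the entries $-1,1$, while the
   identity and ZZ vanish; this gives two independent equations. *)
have e1 := dA (mxtens_index (0, 0)) (mxtens_index (1, 1)) isT.
have e2 := dA (mxtens_index (0, 1)) (mxtens_index (1, 0)) isT.
have entry (A B D : 'M[C]_(2 * 2)) (u v w z : C) i l :
    (u *: 1%:M + v *: A - w *: B - z *: D) i l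
    = u * (i == l)%:R + v * A i l - w * B i l - z * D i l by rewrite !mxE.
rewrite entry !tensmxE !mxE /= in e1; rewrite entry !tensmxE !mxE /= in e2.
have {}e1 : 'i%C * (sa * cb - ca * sb)%:C = 0 :> C.
  rewrite -[RHS]oppr0 -e1 rmorphB; ring: (mulCii R).
have {}e2 : 'i%C * (sa * cb + ca * sb)%:C = 0 :> C.
  rewrite -[RHS]oppr0 -e2 rmorphD; ring: (mulCii R).
move: e1 e2 => /eqP; rewrite mulf_eq0 (negPf i0) /= => /eqP/complexI e1.
move=> /eqP; rewrite mulf_eq0 (negPf i0) /= => /eqP/complexI e2.
have sc : sa * cb = 0 by lra.
have cs : ca * sb = 0 by lra.
have na : ca ^+ 2 + sa ^+ 2 = 1 by exact: cos2Dsin2.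
have nb : cb ^+ 2 + sb ^+ 2 = 1 by exact: cos2Dsin2.
rewrite sc cs !rmorph0 !mulr0 !scale0r !subr0.
(* Either both sines vanish and the product is plus or minus the identity, or both cosines vanish
   and it is plus or minus ZZ. *)
have [sa0|] := eqVneq sa 0.
  exists (ca * cb); split; last by left; rewrite sa0 mul0r rmorph0 scale0r addr0.
  move: na; rewrite sa0 expr0n addr0 => ca1.
  have ca0 : ca != 0.
    by apply/eqP => ca0; move: ca1; rewrite ca0 expr0n => /eqP; rewrite eq_sym oner_eq0.
  move: cs => /eqP; rewrite mulf_eq0 (negPf ca0) => /eqP sb0.
  by move: nb; rewrite sb0 expr0n addr0 exprMn ca1 mul1r.
move=> sa0; move: sc => /eqP; rewrite mulf_eq0 (negPf sa0) => /eqP cb0.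
exists (sa * sb); split; last by right; rewrite cb0 mulr0 rmorph0 scale0r add0r.
move: nb; rewrite cb0 expr0n add0r => sb1.
have sb0 : sb != 0.
  by apply/eqP => sb0; move: sb1; rewrite sb0 expr0n => /eqP; rewrite eq_sym oner_eq0.
move: cs => /eqP; rewrite mulf_eq0 (negPf sb0) orbF => /eqP ca0.
by move: na; rewrite ca0 expr0n add0r exprMn sb1 mulr1.
Qed.

Lemma mulmx_cancel d (A L L' M M' N N' : 'M[C]_d) :
  L' *m L = 1%:M -> N *m N' = 1%:M -> M *m M' = 1%:M ->
  A = L' *m (L *m A *m M *m N) *m N' *m M'.
Proof.
move=> LL NN MM; rewrite -!mulmxA (mulmxA N) NN mul1mx MM mulmx1.
by rewrite mulmxA LL mul1mx.
Qed.

(** The other factors are diagonal with diagonal inverses, so they can be stripped off without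
    losing diagonality. *)
Lemma gate_form_diag (t1 t2 t3 t4 a b c : R) :
  is_diag_mx (gate_form t1 t2 t3 t4 a b (Rpair Z Z c)) ->
  is_diag_mx (Rpair X X a *m Rpair Y Y b).
Proof.
set A := _ *m _; set G := gate_form _ _ _ _ _ _ _ => dG.
have rzK (s t : R) : (RZ s *t RZ t) *m (RZ (- s) *t RZ (- t)) = 1%:M.
  have rK r : RZ r *m RZ (- r) = 1%:M := rotationNK r (mulZZ R).
  by rewrite tensmx_mul -[RHS](@tensmx11 C 2 2); congr (_ *t _); exact: rK.
have zzK : Rpair Z Z c *m Rpair Z Z (- c) = 1%:M.
  exact: rotationNK (tensmx_sqr (mulZZ R) (mulZZ R)).
have -> : A = (RZ (- t1) *t RZ (- t2)) *m G *m (RZ (- t3) *t RZ (- t4)) *m Rpair Z Z (- c).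
  have -> : G = (RZ t1 *t RZ t2) *m A *m Rpair Z Z c *m (RZ t3 *t RZ t4).
    by rewrite /G /gate_form; congr (_ *m _ *m _); exact: esym (mulmxA _ _ _).
  exact: mulmx_cancel (mulmx1C (rzK t1 t2)) (rzK t3 t4) zzK.
have dZZ : is_diag_mx (Z *t Z) by apply: is_diag_tensmx; exact: pauliZ_diag.
have dRZ (s t : R) : is_diag_mx (RZ s *t RZ t).
  by apply: is_diag_tensmx; exact: RZ_diag.
have dR : is_diag_mx (Rpair Z Z (- c)).
  by apply: rotation_diag dZZ; exact: tensmx_sqr (mulZZ R) (mulZZ R).
exact: is_diag_mulmx (is_diag_mulmx (is_diag_mulmx (dRZ _ _) dG) (dRZ _ _)) dR.
Qed.

Lemma mulmx_comm_right d (A M N : 'M[C]_d) : comm_mx M N ->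
  A *m M *m N = A *m 1%:M *m N *m M.
Proof. by move=> MN; rewrite mulmx1 -!mulmxA MN. Qed.

(** To reach the right end, [M] only has to pass the final pair of Z rotations. *)
Lemma gate_form_mulr (t1 t2 t3 t4 a b : R) (M : 'M[C]_(2 * 2)) :
  comm_mx M (RZ t3 *t RZ t4) ->
  gate_form t1 t2 t3 t4 a b M = gate_form t1 t2 t3 t4 a b 1%:M *m M.
Proof. exact: mulmx_comm_right. Qed.

Lemma comm_ZZ_RZ (s t : R) : comm_mx (Z *t Z) (RZ s *t RZ t).
Proof.
have cZ (r : R) : Z *m RZ r = RZ r *m Z.
  by rewrite RZE mulmxBl mulmxBr -!scalemxAr -!scalemxAl mulmx1 mul1mx.
by rewrite /comm_mx !tensmx_mul; congr (_ *t _); exact: cZ.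
Qed.

End Gate.

(** * Gaussianity of the factors on n qubits *)

Section OnQubitsGaussian.
Variables (R : realType) (n : nat) (j k : 'I_n).
Hypothesis neq_jk : j != k.
Local Notation C := R[i].
Local Notation X := (@pauliX R).
Local Notation Y := (@pauliY R).
Local Notation Z := (@pauliZ R).
Local Notation on := (@on_qubits R n j k).

Let nkj : (k == j :> nat) = false. Proof. by rewrite eq_sym; exact: negbTE. Qed.

Lemma on_qubits_comb (x y : C) (A : 'M[C]_(2 * 2)) :
  on (x *: 1%:M - y *: A) = x *: 1%:M - y *: on A.
Proof. by rewrite linearB !linearZ /= on_qubits1. Qed.

Lemma on_qubits_rotation (P Q : 'M[C]_2) (t : R) : P *m P = 1%:M -> Q *m Q = 1%:M ->
  maj_quadratic (on (P *t Q)) -> gaussian_unitary (on (Rpair P Q t)).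
Proof.
move=> PP QQ qPQ; rewrite /Rpair rotationE; last exact: tensmx_sqr.
rewrite on_qubits_comb.
exact: maj_quadratic_rotation qPQ (cos2Dsin2 _).
Qed.

Lemma maj_quadratic_Z (l : 'I_n) : maj_quadratic (tensn n (fun m => if m == l then Z else 1%:M)).
Proof.
(* The factor $i$ in [maj_Z] forces $r=-1$, since $i\cdot(-1)\cdot i=1$. *)
apply: (maj_quadraticP _ _ _ (maj_Z R (ltn_ord l)) (r := -1));
  rewrite ?sqrrN ?expr1n//; try (have := ltn_ord l; lia).
by rewrite rmorphN1; ring: (mulCii R).
Qed.

Lemma on_qubits_Z1 : maj_quadratic (on (Z *t 1%:M)).
Proof.
rewrite on_qubits_tens// (_ : tensn _ _ = tensn n (fun m => if m == j then Z else 1%:M)).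
  exact: maj_quadratic_Z.
by apply: eq_tensn => l _; rewrite /two_site; do 2?case: ifP.
Qed.

Lemma on_qubits_1Z : maj_quadratic (on (1%:M *t Z)).
Proof.
rewrite on_qubits_tens// (_ : tensn _ _ = tensn n (fun m => if m == k then Z else 1%:M)).
  exact: maj_quadratic_Z.
by apply: eq_tensn => l _; rewrite /two_site; case: eqP => // ->; rewrite eq_sym nkj.
Qed.

(** Z on a single qubit is quadratic in the Majorana operators, hence Gaussian; this is a product of
    two such operators, at any distance. *)
Lemma on_qubits_ZZ_gaussian : gaussian_unitary (on (Z *t Z)).
Proof.
rewrite tensmx_split.
rewrite on_qubitsM//; apply: gaussianM; apply: maj_quadratic_gaussian.
  exact: on_qubits_Z1.
exact: on_qubits_1Z.
Qed.

Lemma on_qubits_RZ_gaussian (s t : R) : gaussian_unitary (on (RZ s *t RZ t)).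
Proof.
rewrite tensmx_split on_qubitsM; last exact: neq_jk.
apply: gaussianM.
  rewrite RZE tensmx_comb_l on_qubits_comb.
  exact: maj_quadratic_rotation on_qubits_Z1 (cos2Dsin2 _).
rewrite RZE tensmx_comb_r on_qubits_comb.
exact: maj_quadratic_rotation on_qubits_1Z (cos2Dsin2 _).
Qed.

Lemma on_qubits_XX : k = j.+1 :> nat -> maj_quadratic (on (X *t X)).
Proof.
move=> kj; have kn := ltn_ord k; have jn : (j.+1 < n)%N by rewrite -kj.
rewrite on_qubits_tens// (_ : two_site j k X X =
    fun l => if l == j then X else if l == j.+1 then X else 1%:M).
  by apply: (maj_quadraticP _ _ _ (maj_XX R jn) (r := -1)); rewrite ?sqrrN ?expr1n//; try lia;
    rewrite rmorphN1; ring: (mulCii R).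
by apply/boolp.funext => l; rewrite /two_site kj.
Qed.

Lemma on_qubits_YY : k = j.+1 :> nat -> maj_quadratic (on (Y *t Y)).
Proof.
move=> kj; have kn := ltn_ord k; have jn : (j.+1 < n)%N by rewrite -kj.
rewrite on_qubits_tens// (_ : two_site j k Y Y =
    fun l => if l == j then Y else if l == j.+1 then Y else 1%:M).
  (* The factor in [maj_YY] is $-i$, so here $r=1$. *)
  by apply: (maj_quadraticP _ _ _ (maj_YY R jn) (r := 1)); rewrite ?sqrrN ?expr1n//; try lia;
    rewrite rmorph1; ring: (mulCii R).
by apply/boolp.funext => l; rewrite /two_site kj.
Qed.

End OnQubitsGaussian.

(** * The extent *)

Section LowerBound.
Variables (R : realType) (n : nat) (j k : 'I_n).
Hypothesis neq_jk : j != k.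
Local Notation C := R[i].
Local Notation Mx := 'M[C]_(qdim n).
Local Notation Z := (@pauliZ R).
Local Notation Q := (@conj_string R n).
Local Notation P := (tensn n (two_site j k Z Z)).

Let nkj : (k == j :> nat) = false. Proof. by rewrite eq_sym; exact: negbTE. Qed.

Lemma two_ZZ_sqr : P *m P = 1%:M.
Proof.
rewrite tensn_mul; apply: tensn1 => l _; rewrite /two_site.
by do 2?case: ifP => _; rewrite ?mulZZ ?mulmx1.
Qed.

Lemma two_ZZ_conj : map_mx Num.conj P = P.
Proof.
rewrite tensn_conj; apply: eq_tensn => l _; rewrite /two_site.
by do 2?case: ifP => _; rewrite ?conj_pauliZ ?map_mx1.
Qed.

Lemma two_ZZ_adj : P ^t* = P.
Proof.
rewrite tensn_adj; apply: eq_tensn => l _; rewrite /two_site.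
by do 2?case: ifP => _; rewrite ?adj_pauliZ ?adjmx1.
Qed.

Lemma two_ZZ_trace : \tr P = 0.
Proof. by rewrite mxtrace_tensn (bigD1 j)//= {1}/two_site eqxx trace_pauliZ mul0r. Qed.

(** Z anticommutes with X and with Y, so the two sites [j] and [k] contribute one sign each. *)
Lemma two_ZZ_comm : P *m Q = Q *m P.
Proof.
rewrite !tensn_mul; 
set f : nat -> 'M_2 := fun l => _; set g : nat -> 'M_2 := fun l => _.
have anti (l : nat) : Z *m (if odd (n - l) then pauliY else pauliX) =
    -1 *: ((if odd (n - l) then pauliY else pauliX) *m Z).
  by case: ifP => _; rewrite !mul_pauli scaleN1r scaleNr ?opprK.
(* The intermediate string is already reordered at [j] but not at [k], so that each rewriting
   changes a single factor. *)
pose h (l : nat) := if l == j then g l else f l.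
rewrite (@tensn_scale _ _ h _ j (-1))//; last 2 first.
- by move=> l /negPf lj; rewrite /h lj.
- by rewrite /h eqxx /f /g /two_site eqxx anti.
rewrite (@tensn_scale _ _ g _ k (-1))//; last 2 first.
- move=> l /negPf lk; rewrite /h; case: eqP => // /eqP/negPf lj.
  by rewrite /f /g /two_site lj lk mul1mx mulmx1.
- by rewrite /h nkj /f /g /two_site nkj eqxx anti.
by rewrite scalerA mulrNN mulr1 scale1r.
Qed.

(** The value at $x=0$ is $1$ rather than $0$, which keeps $s^2=1$ in all cases. *)
Lemma norm_sign (x : R) : exists s : R, s ^+ 2 = 1 /\ s * x = `|x|.
Proof.
have [x0|x0] := leP 0 x; first by exists 1; rewrite expr1n mul1r ger0_norm.
by exists (-1); rewrite sqrrN expr1n mulN1r ltr0_norm.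
Qed.

Lemma decomposition_norm1_ge (W : Mx) (x y : R) chi (c : chi.-tuple C)
    (K : chi.-tuple Mx) : gaussian_unitary W ->
  gaussian_decomposition (W *m (x%:C *: 1%:M - ('i%C * y%:C) *: P)) c K ->
  `|x| + `|y| <= norm1 c.
Proof.
move=> gW [gK DE].
have [s [s1 sx]] := norm_sign x; have [t [t1 ty]] := norm_sign y.
(* The dual witness: with these signs it equals $2^n(|x|+|y|)$ on the target, and it has modulus at
   most $2^n$ on Gaussian unitaries. *)
pose f (A : Mx) : C := s%:C * \tr A + 'i%C * t%:C * \tr (P *m A).
have fD : f (x%:C *: 1%:M - ('i%C * y%:C) *: P) = (`|x| + `|y|)%:C * (qdim n)%:R.
  rewrite /f mulmxBr -!scalemxAr mulmx1 two_ZZ_sqr !raddfB /= !mxtraceZ mxtrace1 two_ZZ_trace.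
  by rewrite -sx -ty rmorphD !rmorphM /=; ring: (mulCii R).
have DE' : x%:C *: 1%:M - ('i%C * y%:C) *: P = \sum_i tnth c i *: (W ^t* *m tnth K i).
  have [uW _] := gW; have := congr1 (mulmx (W ^t*)) DE.
  rewrite mulmxA (unitary_mulVmx uW) mul1mx => ->; rewrite mulmx_sumr.
  by apply: eq_bigr => i _; rewrite scalemxAr.
have fS : f (\sum_i tnth c i *: (W ^t* *m tnth K i)) = \sum_i tnth c i * f (W ^t* *m tnth K i).
  rewrite /f mulmx_sumr !raddf_sum !mulr_sumr -big_split; apply: eq_bigr => i _ /=.
  by rewrite -scalemxAr !mxtraceZ; ring.
have N0 : 0 < (qdim n)%:R :> C by rewrite ltr0n qdim_gt0.
rewrite -lecR -(ler_pM2r N0) -fD DE' fS.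
(* The sum is a nonnegative real, so it equals its own modulus and the triangle inequality
   applies. *)
have -> : \sum_i tnth c i * f (W ^t* *m tnth K i)
    = `|\sum_i tnth c i * f (W ^t* *m tnth K i)|.
  by rewrite -fS -DE' fD [RHS]ger0_norm// mulr_ge0 ?ler0n// ler0c addr_ge0.
apply: le_trans (ler_norm_sum _ _ _) _.
rewrite rmorph_sum mulr_suml; apply: ler_sum => i _.
rewrite normrM; apply: (ler_wpM2l (normr_ge0 (tnth c i))).
have gWK : gaussian_unitary (W ^t* *m tnth K i) by apply: gaussianM; [exact: gaussian_adj|].
rewrite /f.
exact: (gaussian_trace_bound two_ZZ_sqr two_ZZ_adj two_ZZ_conj two_ZZ_trace two_ZZ_comm gWK s1 t1).
Qed.

End LowerBound.

Lemma comm_mx_comb (F : comPzRingType) d (x y : F) (A N : 'M[F]_d) : comm_mx A N ->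
  comm_mx (x *: 1%:M - y *: A) N.
Proof.
move=> AN.
by rewrite /comm_mx mulmxBl mulmxBr -!scalemxAl -!scalemxAr mul1mx mulmx1 AN.
Qed.

(** A least element is unique by antisymmetry, so [xget] can only return [x]. *)
Lemma unitary_extentE (R : realType) n (V : 'M[R[i]]_(qdim n)) (x : R) :
  extent_values V x -> lbound (extent_values V) x -> unitary_extent V = x.
Proof.
move=> Vx lx; apply: xget_unique => [//|y [Vy ly]].
by apply/eqP; rewrite eq_le lx// ly.
Qed.

Theorem lemma18 (R : realType) (n : nat) (j k : 'I_n) (U : 'M[R[i]]_(2 * 2))
    (t1 t2 t3 t4 a b c : R) (phi : R[i])
    (neq_jk : j != k)
    (unitaryU : U \is unitarymx)
    (fermionicU : comm_mx U (pauliZ *t pauliZ))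
    (phase : `|phi| = 1)
    (defU : U = phi *: gate_form t1 t2 t3 t4 a b (Rpair pauliZ pauliZ c))
    (nn_or_diag : k = j.+1 :> nat \/ is_diag_mx U) :
  unitary_extent (on_qubits j k U) = 1 + `|sin c| /\
  U = phi *: gate_form t1 t2 t3 t4 a b
        ((cos (c / 2))%:C *: 1%:M
         - ('i%C * (sin (c / 2))%:C) *: (pauliZ *t pauliZ)) /\
  optimal_decomposition (on_qubits j k U)
    [tuple (cos (c / 2))%:C; - ('i%C * (sin (c / 2))%:C)]
    [tuple on_qubits j k (phi *: gate_form t1 t2 t3 t4 a b 1%:M);
           on_qubits j k (phi *: gate_form t1 t2 t3 t4 a b
                                   (pauliZ *t pauliZ))].
Proof.
have RzzE : Rpair pauliZ pauliZ c = (cos (c / 2))%:C *: 1%:M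
    - ('i%C * (sin (c / 2))%:C) *: (pauliZ *t pauliZ).
  exact: rotationE (tensmx_sqr (mulZZ R) (mulZZ R)).
set x := cos (c / 2) in RzzE *; set y := sin (c / 2) in RzzE *.
set G := gate_form t1 t2 t3 t4 a b in defU *.
pose W := on_qubits j k (phi *: G 1%:M).
have phi0 : phi != 0.
  by apply/eqP => phi0; move: phase; rewrite phi0 normr0 => /eqP; rewrite eq_sym oner_eq0.
(* The two cases of the theorem differ only here: neighbouring qubits make XX and YY quadratic,
   while a diagonal gate reduces this product to plus or minus the identity or ZZ. *)
have gA : gaussian_unitary (on_qubits j k (Rpair pauliX pauliX a *m Rpair pauliY pauliY b)).
  case: nn_or_diag => [kj|dU].
    rewrite on_qubitsM//; apply: gaussianM.
      exact: on_qubits_rotation (mulXX R) (mulXX R) (on_qubits_XX R neq_jk kj).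
    exact: on_qubits_rotation (mulYY R) (mulYY R) (on_qubits_YY R neq_jk kj).
  have dG : is_diag_mx (G (Rpair pauliZ pauliZ c)).
    have -> : G (Rpair pauliZ pauliZ c) = phi^-1 *: U by rewrite defU scalerA mulVf// scale1r.
    exact: is_diag_scalemx.
  have [e [e1 AE]] := diag_RXX_RYY (gate_form_diag dG).
  have ne : `|e%:C| = 1 :> R[i].
    by rewrite normc_def /= expr0n addr0 e1 sqrtr1.
  case: AE => ->; rewrite linearZ; apply: gaussianZ => //=.
    by rewrite on_qubits1//; exact: gaussian1.
  exact: on_qubits_ZZ_gaussian.
have gW : gaussian_unitary W.
  have GE : G 1%:M = (RZ t1 *t RZ t2)
      *m (Rpair pauliX pauliX a *m Rpair pauliY pauliY b) *m (RZ t3 *t RZ t4).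
    by rewrite /G /gate_form mulmx1; congr (_ *m _); exact: esym (mulmxA _ _ _).
  have -> : W = phi *: (on_qubits j k (RZ t1 *t RZ t2)
      *m on_qubits j k (Rpair pauliX pauliX a *m Rpair pauliY pauliY b)
      *m on_qubits j k (RZ t3 *t RZ t4)).
    by rewrite /W GE -!(on_qubitsM neq_jk); exact: linearZ.
  apply: gaussianZ phase _; apply: gaussianM; last exact: on_qubits_RZ_gaussian.
  by apply: gaussianM gA; exact: on_qubits_RZ_gaussian.
have WM M : comm_mx M (RZ t3 *t RZ t4) ->
    on_qubits j k (phi *: G M) = W *m on_qubits j k M.
  by move=> cM; rewrite /W -(on_qubitsM neq_jk) -scalemxAl -gate_form_mulr.
have PE : on_qubits j k (pauliZ *t pauliZ) = tensn n (two_site j k (@pauliZ R) pauliZ).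
  exact: on_qubits_tens.
have WZZ := WM _ (comm_ZZ_RZ t3 t4).
have DE : on_qubits j k U = W *m (x%:C *: 1%:M
    - ('i%C * y%:C) *: tensn n (two_site j k pauliZ pauliZ)).
  rewrite defU RzzE WM; last by apply: comm_mx_comb; exact: comm_ZZ_RZ.
  by rewrite on_qubits_comb// PE.
set cs : 2.-tuple R[i] := [tuple _; _]; set Ks := [tuple _; _].
have dec : gaussian_decomposition (on_qubits j k U) cs Ks.
  split=> [i|].
    case: i => [[|[|//]] ilt]; rewrite (tnth_nth 0) /=; first exact: gW.
    rewrite WZZ; apply: gaussianM gW _; exact: on_qubits_ZZ_gaussian.
  transitivity (x%:C *: W + - ('i%C * y%:C) *: (W *m on_qubits j k (pauliZ *t pauliZ))).
    by rewrite PE DE mulmxBr -!scalemxAr mulmx1 scaleNr.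
  by rewrite -WZZ big_ord_recl big_ord1 !(tnth_nth 0).
have n1 : norm1 cs = `|x| + `|y|.
  rewrite /norm1 !big_ord_recl big_ord0 !(tnth_nth 0) /= addr0.
  by rewrite !(mul0r, mul1r, mulr0, sub0r, add0r, subr0, oppr0) expr0n addr0 add0r sqrrN !sqrtr_sqr.
have nE : norm1 cs ^+ 2 = 1 + `|sin c|.
  (* By the double angle formula, $(|x|+|y|)^2=x^2+y^2+2|xy|=1+|\sin c|$. *)
  have -> : sin c = 2 * (x * y).
    by rewrite [c in LHS](splitr c) sinD -/x -/y; ring.
  rewrite n1 sqrrD !real_normK ?num_real// addrAC cos2Dsin2 !normrM ger0_norm//.
  by rewrite mulr2n; ring.
have ext : unitary_extent (on_qubits j k U) = norm1 cs ^+ 2.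
  apply: unitary_extentE; first by exists 2, cs, Ks.
  move=> _ [chi [c' [K' [d ->]]]]; rewrite n1.
  (* Squaring is monotone on nonnegative reals, so the bound on the 1-norm suffices. *)
  rewrite lerXn2r ?nnegrE ?addr_ge0//.
    by apply: sumr_ge0 => i _; rewrite -lecR;
      exact: (normr_ge0 (tnth c' i)).
  by apply: (decomposition_norm1_ge neq_jk gW (K := K')); rewrite -DE.
split; first by rewrite ext.
split; first by rewrite {1}defU RzzE.
by split.
Qed.
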